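(* Let $p_0$ be a probability density on $\mathbb{R}^d$ with $p_0(\theta)>0$ for all $\theta\in\mathbb{R}^d$, let $\lambda>0$, and assume that the stage costs satisfy $\ell_t(\cdot,\cdot)\ge 0$ for $t=0,\dots,T-1$ and the terminal cost satisfies $\ell_T(\cdot)\ge 0$. Define the energy function $$E(\theta)=\mathbb{E}_{x_0\sim\mu}\left[J(\tau(x_0,\theta))\right],\qquad \theta\in\mathbb{R}^d,$$ and assume that $E:\mathbb{R}^d\to\mathbb{R}$ is finite-valued and measurable. Consider the problem of minimizing, over probability densities $p$ on $\mathbb{R}^d$, $$\min_{p}\ \mathbb{E}_{x_0\sim\mu,\ \theta\sim p}\left[J(\tau(x_0,\theta))\right]+\lambda D_{\mathrm{KL}}(p\,\|\,p_0).$$ Then the optimal distribution $p^\star$ (the minimizer, as a density up to almost-everywhere equality) of this problem is given by $$p^\star(\theta)=\frac{1}{Z}\,p_0(\theta)\exp\left(-\frac{1}{\lambda}E(\theta)\right),\qquad Z=\int_{\mathbb{R}^d}p_0(\theta)\exp\left(-\frac{1}{\lambda}E(\theta)\right)d\theta ,$$ where $Z$ is the normalizing constant.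
   Context: Setting: a discrete-time deterministic dynamical system $x_{t+1}=f(x_t,u_t)$ with state $x_t\in\mathbb{R}^n$ and control $u_t\in\mathbb{R}^m$, and a finite horizon $T$. A trajectory is $\tau=(x_0,u_0,x_1,u_1,\dots,x_{T-1},u_{T-1},x_T)$, and its total cost is $J(\tau)=\sum_{t=0}^{T-1}\ell_t(x_t,u_t)+\ell_T(x_T)$, where $\ell_t:\mathbb{R}^n\times\mathbb{R}^m\to\mathbb{R}$ ($t=0,\dots,T-1$) are stage costs and $\ell_T:\mathbb{R}^n\to\mathbb{R}$ is a terminal cost. $\mu$ is a probability distribution on initial states $x_0\in\mathbb{R}^n$. A parameter $\theta\in\mathbb{R}^d$ determines a controller $\pi_\theta:\mathbb{R}^n\to\mathbb{R}^m$, and $\tau(x_0,\theta)$ denotes the trajectory obtained by starting at $x_0$ and applying $u_t=\pi_\theta(x_t)$, $x_{t+1}=f(x_t,u_t)$ for $t=0,\dots,T-1$. The map $(x_0,\theta)\mapsto J(\tau(x_0,\theta))$ is assumed measurable, and $x_0\sim\mu$ and $\theta\sim p$ are drawn independently. The Kullback--Leibler divergence is $D_{\mathrm{KL}}(p\,\|\,p_0)=\int_{\mathbb{R}^d}p(\theta)\log\frac{p(\theta)}{p_0(\theta)}\,d\theta$ (which may be $+\infty$). *)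

(* Defs.v *)
From HB Require Import structures.
From mathcomp Require Import all_boot all_order all_algebra.
From mathcomp Require Import all_classical all_reals all_analysis.
From mathcomp Require Import measurable_realfun.

Set Implicit Arguments.
Unset Strict Implicit.
Unset Printing Implicit Defensive.

Import Order.TTheory GRing.Theory Num.Theory.
Import numFieldNormedType.Exports.

Local Open Scope classical_set_scope.
Local Open Scope ring_scope.

(* R^n as n-tuples: the measurable sets are those generated by the coordinate
   projections, i.e. the Borel sets. *)
Notation "''R[' R ]_ n" := (n.-tuple (measurableTypeR R))
  (at level 8, n at level 2, format "''R[' R ]_ n") : type_scope.

Section tuple_cons.
Context d (T : measurableType d) (n : nat).

Definition tcons (xv : (T * n.-tuple T)%type) : n.+1.-tuple T :=
  [tuple of xv.1 :: xv.2].

Lemma measurable_tcons : measurable_fun setT tcons.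
Proof. exact: measurable_cons. Qed.

HB.instance Definition _ := isMeasurableFun.Build _ _ _ _ tcons measurable_tcons.

Definition tuncons (v : n.+1.-tuple T) : (T * n.-tuple T)%type :=
  (thead v, [tuple of behead v]).

Lemma measurable_tuncons : measurable_fun setT tuncons.
Proof.
apply: measurable_fun_pair; first exact: measurable_tnth.
exact: measurable_behead.
Qed.

Lemma tconsK : cancel tcons tuncons.
Proof.
by move=> [x v]; rewrite /tuncons /tcons theadE; congr pair; exact: val_inj.
Qed.

Lemma tunconsK : cancel tuncons tcons.
Proof. by move=> v; rewrite [RHS]tuple_eta. Qed.

Context (R : realType) (m1 : {sigma_finite_measure set T -> \bar R})
  (m2 : {sigma_finite_measure set (n.-tuple T) -> \bar R}).

Definition mtcons : set (n.+1.-tuple T) -> \bar R := pushforward (m1 \x m2)%E tcons.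

Let mtcons0 : mtcons set0 = 0%E.
Proof. exact: measure0. Qed.

Let mtcons_ge0 A : (0 <= mtcons A)%E.
Proof. exact: measure_ge0. Qed.

Let mtcons_sigma_additive : semi_sigma_additive mtcons.
Proof.
exact: measure_semi_sigma_additive.
Qed.

HB.instance Definition _ := isMeasure.Build _ _ _
  mtcons mtcons0 mtcons_ge0 mtcons_sigma_additive.

Let mtcons_sigma_finite : sigma_finite setT mtcons.
Proof.
have /sigma_finiteP[F [FT ndF mF]] := sigma_finiteT m1.
have /sigma_finiteP[G [GT ndG mG]] := sigma_finiteT m2.
exists (fun k => tuncons @^-1` (F k `*` G k)).
  apply/esym; rewrite -subTset => v _.
  have [i _ Fi] : (\bigcup_i F i) (tuncons v).1 by rewrite -FT.
  have [j _ Gj] : (\bigcup_i G i) (tuncons v).2 by rewrite -GT.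
  exists (maxn i j) => //; split.
  - by move: Fi; exact/subsetPset/ndF/leq_maxl.
  - by move: Gj; exact/subsetPset/ndG/leq_maxr.
move=> k; have [mFk Fkoo] := mF k; have [mGk Gkoo] := mG k; split.
  rewrite -[X in measurable X]setTI; apply: measurable_tuncons => //.
  exact: measurableX.
rewrite /mtcons /pushforward -comp_preimage.
rewrite (_ : _ \o _ = id); last by apply/funext => x /=; rewrite tconsK.
by rewrite preimage_id product_measure1E// lte_mul_pinfty// ge0_fin_numE.
Qed.

HB.instance Definition _ :=
  Measure_isSigmaFinite.Build _ _ _ mtcons mtcons_sigma_finite.

End tuple_cons.

Section lebesgue_Rn.
Context (R : realType).
Local Open Scope ereal_scope.

(* Lebesgue measure on R^n (on Borel sets), as an iterated product measure *)
Fixpoint lebesgueRn (n : nat) : {sigma_finite_measure set 'R[R]_n -> \bar R} :=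
  match n with
  | 0 => \d_([tuple] : 'R[R]_0)
  | k.+1 => mtcons lebesgue_measure (lebesgueRn k)
  end.

Lemma lebesgueRn_box n (A : 'I_n -> set (measurableTypeR R)) :
  (forall i, measurable (A i)) ->
  lebesgueRn n [set v | forall i, A i (tnth v i)] =
  \prod_(i < n) lebesgue_measure (A i).
Proof.
elim: n A => [|n IHn] A mA /=.
  by rewrite big_ord0 diracE mem_set // => -[].
rewrite /mtcons /pushforward.
rewrite (_ : _ @^-1` _ = A ord0 `*`
    [set v : 'R[R]_n | forall i, A (lift ord0 i) (tnth v i)]); last first.
  apply/seteqP; split => [[x v] /= Av|[x v] [/= A0 Av] i].
    split; first by have := Av ord0.
    by move=> i; have := Av (lift ord0 i); rewrite tnthS.
  have [j ->|->//] := unliftP ord0 i.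
  by rewrite tnthS; exact: Av.
rewrite big_ord_recl product_measure1E//.
  by congr (_ * _); apply: (IHn (fun i => A (lift ord0 i))).
rewrite (_ : [set v | _] = \bigcap_(i in [set: 'I_n])
    ((fun v : 'R[R]_n => tnth v i) @^-1` A (lift ord0 i))); last first.
  by apply/seteqP; split => v /= Av i; [move=> _; exact: Av|exact: Av].
apply: fin_bigcap_measurable; first exact: finite_finset.
by move=> i _; rewrite -[X in measurable X]setTI; exact: measurable_tnth.
Qed.

End lebesgue_Rn.

Section density.
Context d (T : measurableType d) (R : realType)
  (nu : {measure set T -> \bar R}).
Local Open Scope ereal_scope.

Record density := Density {
  density_fun :> T -> R ;
  density_ge0 : forall x, (0 <= density_fun x)%R ;
  measurable_density : measurable_fun setT density_fun ;
  density_int1 : \int[nu]_x (density_fun x)%:E = 1 }.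

Definition density_prob (p : density) : set T -> \bar R :=
  fun A => \int[nu]_(x in A) (p x)%:E.

Section density_probability.
Variable p : density.

Let prob0 : density_prob p set0 = 0.
Proof. by rewrite /density_prob integral_set0. Qed.

Let prob_ge0 A : 0 <= density_prob p A.
Proof. by apply: integral_ge0 => x _; rewrite lee_fin density_ge0. Qed.

Let prob_sigma_additive : semi_sigma_additive (density_prob p).
Proof.
apply: semi_sigma_additive_nng_induced.
  by apply/measurable_EFinP; exact: measurable_density.
by move=> x; rewrite lee_fin density_ge0.
Qed.

HB.instance Definition _ := isMeasure.Build _ _ _
  (density_prob p) prob0 prob_ge0 prob_sigma_additive.

Let probT : density_prob p [set: T] = 1.
Proof. exact: density_int1. Qed.

HB.instance Definition _ :=
  Measure_isProbability.Build _ _ _ (density_prob p) probT.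

End density_probability.

(* [ln 0 = 0] in the library, so the integrand vanishes where [p] does
   (0 log 0 = 0). Its negative part is at most [q] wherever [q > 0], so for
   everywhere positive [q] the integral is a well-defined element of [0, +oo]. *)
Definition KL (p q : density) : \bar R :=
  \int[nu]_x (p x * ln (p x / q x))%:E.

End density.

Record trajectory (X U : Type) (T : nat) := Trajectory {
  state : 'I_T.+1 -> X ;
  control : 'I_T -> U }.

Definition total_cost (R : realType) (X U : Type) (T : nat)
    (ell : 'I_T -> X -> U -> R) (ellT : X -> R) (tau : trajectory X U T) : R :=
  \sum_(t < T) ell t (state tau (widen_ord (leqnSn T) t)) (control tau t)
  + ellT (state tau ord_max).

Definition rollout (X U : Type) (T : nat) (f : X -> U -> X) (pi : X -> U)
    (x0 : X) : trajectory X U T :=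
  let x t := iter t (fun y => f y (pi y)) x0 in
  Trajectory (fun t : 'I_T.+1 => x t) (fun t : 'I_T => pi (x t)).

Section control_problem.
Context (R : realType) (n m d T : nat).
Variables (f : 'R[R]_n -> 'R[R]_m -> 'R[R]_n)
  (ell : 'I_T -> 'R[R]_n -> 'R[R]_m -> R) (ellT : 'R[R]_n -> R)
  (pi : 'R[R]_d -> 'R[R]_n -> 'R[R]_m) (mu : probability 'R[R]_n R).
Local Open Scope ereal_scope.

Definition rollout_cost (x0 : 'R[R]_n) (theta : 'R[R]_d) : R :=
  total_cost ell ellT (rollout T f (pi theta) x0).

Definition energy (theta : 'R[R]_d) : \bar R :=
  'E_mu[fun x0 => rollout_cost x0 theta].

(* independence of [x0 ~ mu] and [theta ~ p]: their joint law is the product *)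
Definition objective (p0 : density (lebesgueRn R d)) (lambda : R)
    (p : density (lebesgueRn R d)) : \bar R :=
  'E_(mu \x density_prob p)[fun z => rollout_cost z.1 z.2]
  + lambda%:E * KL p p0.

End control_problem.

Definition is_minimizer (R : realType) (P : Type) (F : P -> \bar R) (p : P) :=
  forall q : P, (F p <= F q)%E.

(* Main.v *)
Require Import Defs.
From mathcomp Require Import all_boot all_order all_algebra.
From mathcomp Require Import all_classical all_reals all_analysis.
From mathcomp Require Import measurable_realfun.
From mathcomp Require Import ring lra.

Import Order.TTheory GRing.Theory Num.Theory.
Import numFieldNormedType.Exports.

Local Open Scope classical_set_scope.
Local Open Scope ring_scope.

(**
  Writing [q] for the Gibbs density [p0 exp(- E / lambda) / Z], one has
  [p E + lambda p ln (p / p0) = lambda p ln (p / q) - lambda (ln Z) p] pointwise,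
  so the objective at [p] equals [lambda KL(p, q) - lambda ln Z], and [KL(p, q)] is
  nonnegative and vanishes exactly when [p = q] almost everywhere.
*)

(** * The nonnegative integrand behind the Kullback-Leibler divergence *)

Section pointwise_divergence.
Context {R : realType}.
Implicit Types a b : R.

(* For densities, [b - a] integrates to 0, so this nonnegative function has the
   same integral as [a ln (a / b)]. *)
Definition pdiv a b : R := a * ln (a / b) + (b - a).

(** For [a > 0], the strict inequality [1 + t < expR t] at [t = ln (b / a)], multiplied by [a],
    reads [a + a * t < b]. For [a = 0] the value is [b] itself. *)
Lemma pdiv_gt0 a b : 0 <= a -> 0 < b -> a != b -> 0 < pdiv a b.
Proof.
rewrite le_eqVlt => /predU1P[<- b0 _|a0 b0 ab].
  by rewrite /pdiv mul0r subr0 add0r.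
have ba : expR (ln (b / a)) = b / a by rewrite lnK// posrE divr_gt0.
have t0 : ln (b / a) != 0.
  rewrite ln_eq0 ?divr_gt0//; apply: contra_neq ab => ba1.
  by rewrite -[LHS]mulr1 -ba1 mulrCA divff ?mulr1// gt_eqF.
have := expR_gt1Dx t0; rewrite ba -(ltr_pM2l a0) mulrCA divff ?gt_eqF// mulr1.
rewrite /pdiv -[a / b]invf_div lnV ?posrE ?divr_gt0//.
by rewrite mulrDr mulr1 mulrN => ?; lra.
Qed.

Lemma pdivxx a : 0 < a -> pdiv a a = 0.
Proof. by move=> a0; rewrite /pdiv divff ?gt_eqF// ln1 mulr0 subrr addr0. Qed.

Lemma pdiv_ge0 a b : 0 <= a -> 0 < b -> 0 <= pdiv a b.
Proof.
move=> a0 b0; have [->|ab] := eqVneq a b; first by rewrite pdivxx.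
exact/ltW/pdiv_gt0.
Qed.

(** The factor [a] makes both sides vanish at [a = 0], so the logarithm can be split even where a
    density is zero. *)
Lemma mulr_ln_div a b : 0 <= a -> 0 < b -> a * ln (a / b) = a * (ln a - ln b).
Proof.
rewrite le_eqVlt => /predU1P[<- _|a0 b0]; first by rewrite !mul0r.
by rewrite ln_div.
Qed.

End pointwise_divergence.

(** * Nonnegativity and the equality case of the Kullback-Leibler divergence *)

Section kullback_leibler.
Context {d} {T : measurableType d} {R : realType}
  {nu : {measure set T -> \bar R}}.
Implicit Types (f g : T -> R) (p q : density nu).
Local Open Scope ereal_scope.

Lemma ge0_integral_EFinD f g :
    measurable_fun setT f -> measurable_fun setT g ->
    (forall x, (0 <= f x)%R) -> (forall x, (0 <= g x)%R) ->
  \int[nu]_x (f x + g x)%:E = \int[nu]_x (f x)%:E + \int[nu]_x (g x)%:E.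
Proof.
move=> mf mg f0 g0; under eq_integral do rewrite EFinD.
by rewrite ge0_integralD//; [move=> x _; rewrite lee_fin|exact/measurable_EFinP|
  move=> x _; rewrite lee_fin|exact/measurable_EFinP].
Qed.

Lemma ge0_integral_EFinZl f (k : R) :
    measurable_fun setT f -> (forall x, (0 <= f x)%R) -> (0 <= k)%R ->
  \int[nu]_x (k * f x)%:E = k%:E * \int[nu]_x (f x)%:E.
Proof.
move=> mf f0 k0; under eq_integral do rewrite EFinM.
by rewrite ge0_integralZl_EFin//; [move=> x _; rewrite lee_fin|
  exact/measurable_EFinP].
Qed.

Lemma measurable_mulr_ln_div p q : (forall x, (0 < q x)%R) ->
  measurable_fun setT (fun x => p x * ln (p x / q x))%R.
Proof.
move=> q0; apply: (eq_measurable_fun (fun x => p x * (ln (p x) - ln (q x)))%R).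
  by move=> x _; rewrite mulr_ln_div// density_ge0.
apply: measurable_funM; first exact: measurable_density.
by apply: measurable_funB; apply: measurableT_comp => //;
  exact: measurable_density.
Qed.

Lemma measurable_pdiv p q : (forall x, (0 < q x)%R) ->
  measurable_fun setT (fun x => pdiv (p x) (q x)).
Proof.
move=> q0; apply: measurable_funD; first exact: measurable_mulr_ln_div.
by apply: measurable_funB; exact: measurable_density.
Qed.

(** The correction [q - p] integrates to 0. Since [p ln (p / q)] may have integral [+oo], its
    positive and negative parts are treated separately, and only the negative part is shown to have
    a finite integral. *)
Lemma KL_pdiv p q : (forall x, (0 < q x)%R) ->
  KL p q = \int[nu]_x (pdiv (p x) (q x))%:E.
Proof.
move=> q0; rewrite /KL; set f := fun x => (p x * ln (p x / q x))%R.
have mf : measurable_fun setT f by exact: measurable_mulr_ln_div.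
pose fp x := Num.max (f x) 0%R; pose fn x := Num.max (- f x)%R 0%R.
have mfp : measurable_fun setT fp by exact: measurable_maxr.
have mfn : measurable_fun setT fn.
  by apply: measurable_maxr => //; exact: measurable_funN.
have mp := measurable_density p; have mq := measurable_density q.
have p0 := density_ge0 p; have q0' := density_ge0 q.
have md := measurable_pdiv p q q0.
have d0 x : (0 <= pdiv (p x) (q x))%R by exact: pdiv_ge0.
have fp0 x : (0 <= fp x)%R by rewrite le_max lexx orbT.
have fn0 x : (0 <= fn x)%R by rewrite le_max lexx orbT.
have fpn x : f x = (fp x - fn x)%R.
  by rewrite /fp /fn; case: (leP (f x) 0%R); case: (leP (- f x)%R 0%R); lra.
(* [pdiv p q >= 0] gives [- f <= q - p <= q]. *)
have fnq x : (fn x <= q x)%R.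
  rewrite ge_max q0' andbT; have := d0 x; have := p0 x.
  by rewrite /pdiv -/(f x); lra.
have intfn : \int[nu]_x (fn x)%:E \is a fin_num.
  rewrite ge0_fin_numE; last by apply: integral_ge0 => x _; rewrite lee_fin.
  apply: (@le_lt_trans _ _ 1); last exact: ltry.
  rewrite -(density_int1 q); apply: ge0_le_integral => //.
  - by move=> x _; rewrite lee_fin.
  - exact/measurable_EFinP.
  - exact/measurable_EFinP.
  - by move=> x _; rewrite lee_fin.
(* [fp - fn = pdiv p q + p - q], rearranged into sums of nonnegative functions
   because [fp] need not be integrable. *)
have : \int[nu]_x (fp x + q x)%:E =
    \int[nu]_x (pdiv (p x) (q x) + (p x + fn x))%:E.
  by apply: eq_integral => x _; congr EFin; rewrite /pdiv -/(f x) fpn; ring.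
rewrite ge0_integral_EFinD// (ge0_integral_EFinD (fun x => pdiv (p x) (q x)))//;
  [|exact: measurable_funD|by move=> x; rewrite addr_ge0].
rewrite (ge0_integral_EFinD p)// !density_int1.
(* Cancelling the masses of [p] and [q] leaves the integral of [fp] as that of [pdiv p q] plus that
   of [fn]; the last is finite and is subtracted at the end. *)
rewrite [1 + _]addeC addeA => /(congr1 (fun y => y - 1)).
rewrite /= !addeK// => h.
rewrite integralE.
rewrite (_ : \int[nu]_x _^\+ x = \int[nu]_x (fp x)%:E); last first.
  by apply: eq_integral => x _; rewrite funeposE /fp EFin_max.
rewrite (_ : \int[nu]_x _^\- x = \int[nu]_x (fn x)%:E); last first.
  by apply: eq_integral => x _; rewrite funenegE /fn EFin_max EFinN.
by rewrite h addeK.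
Qed.

Lemma KL_ge0 p q : (forall x, (0 < q x)%R) -> 0 <= KL p q.
Proof.
move=> q0; rewrite KL_pdiv//; apply: integral_ge0 => x _.
by rewrite lee_fin pdiv_ge0// density_ge0.
Qed.

(** A nonnegative function has zero integral iff it vanishes almost everywhere, and [pdiv a b]
    vanishes only for [a = b]. *)
Lemma KL_eq0 p q : (forall x, (0 < q x)%R) ->
  KL p q = 0 <-> {ae nu, forall x, p x = q x}.
Proof.
move=> q0; rewrite KL_pdiv//.
have md := measurable_pdiv p q q0.
have d0 x : (0 <= pdiv (p x) (q x))%R by rewrite pdiv_ge0// density_ge0.
have -> : \int[nu]_x (pdiv (p x) (q x))%:E =
          \int[nu]_x `|(pdiv (p x) (q x))%:E|.
  by apply: eq_integral => x _; rewrite gee0_abs// lee_fin.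
rewrite ae_eq_integral_abs//; last exact/measurable_EFinP.
split; apply: filterS => x.
  move=> /(_ I) [h]; apply/eqP; apply: contra_eqT h => pq.
  by rewrite gt_eqF// pdiv_gt0// density_ge0.
by move=> -> _ /=; rewrite pdivxx.
Qed.

(** * Gibbs densities: the free energy identity and the partition function *)

Lemma free_energy_KL (p p0 q : density nu) (E : T -> R) (lambda Z : R) :
    measurable_fun setT E -> (forall x, (0 <= E x)%R) ->
    (forall x, (0 < p0 x)%R) -> (0 < lambda)%R -> (0 < Z <= 1)%R ->
    (forall x, q x = 1 / Z * p0 x * expR (- (1 / lambda * E x)))%R ->
  \int[nu]_x (p x * E x)%:E + lambda%:E * KL p p0 =
  lambda%:E * KL p q + (- (lambda * ln Z))%:E.
Proof.
move=> mE E0 p00 l0 /andP[Z0 Z1] qE.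
have q0 x : (0 < q x)%R by rewrite qE !mulr_gt0 ?expR_gt0// invr_gt0.
have c0 : (0 <= - ln Z)%R by rewrite oppr_ge0 ln_le0.
have mp := measurable_density p; have mq := measurable_density q.
have mp0 := measurable_density p0; have pge0 := density_ge0 p.
have qge0 := density_ge0 q; have p0ge0 := density_ge0 p0.
have mpE : measurable_fun setT (fun x => p x * E x)%R by exact: measurable_funM.
have pE0 x : (0 <= p x * E x)%R by exact: mulr_ge0.
have md0 := measurable_pdiv p p0 p00; have md := measurable_pdiv p q q0.
have d00 x : (0 <= pdiv (p x) (p0 x))%R by exact: pdiv_ge0.
have d0 x : (0 <= pdiv (p x) (q x))%R by exact: pdiv_ge0.
have lge0 := ltW l0.
have lc0 : (0 <= - (lambda * ln Z))%R by rewrite -mulrN mulr_ge0.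
have mZ (k : R) (f : T -> R) : measurable_fun setT f ->
    measurable_fun setT (fun x => k * f x)%R by exact: measurable_funM.
have Zge0 (k : R) (f : T -> R) : (0 <= k)%R -> (forall x, 0 <= f x)%R ->
    forall x, (0 <= k * f x)%R by move=> k0 f0 x; exact: mulr_ge0.
have mlq := mZ lambda _ mq; have mlp0 := mZ lambda _ mp0.
have mcp := mZ (- (lambda * ln Z))%R _ mp.
have mld := mZ lambda _ md; have mld0 := mZ lambda _ md0.
have lq0 := Zge0 lambda _ lge0 qge0; have lp00 := Zge0 lambda _ lge0 p0ge0.
have cp0 := Zge0 _ _ lc0 pge0.
have ld0 := Zge0 lambda _ lge0 d0; have ld00 := Zge0 lambda _ lge0 d00.
(* [lambda q] is added on the left so that all the terms are nonnegative
   ([- ln Z >= 0] since [Z <= 1]) and the integrals split. *)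
have pointwise x : (p x * E x + lambda * pdiv (p x) (p0 x) + lambda * q x =
    lambda * pdiv (p x) (q x) + (lambda * p0 x + (- (lambda * ln Z)) * p x))%R.
  rewrite /pdiv !mulr_ln_div//.
  have -> : ln (q x) = (- ln Z + ln (p0 x) - E x / lambda)%R.
    rewrite qE !div1r !lnM ?posrE ?mulr_gt0 ?expR_gt0 ?invr_gt0// expRK lnV//.
    by rewrite mulrC.
  by field; rewrite gt_eqF.
have : \int[nu]_x (p x * E x + lambda * pdiv (p x) (p0 x) + lambda * q x)%:E =
    \int[nu]_x (lambda * pdiv (p x) (q x) +
      (lambda * p0 x + (- (lambda * ln Z)) * p x))%:E.
  by apply: eq_integral => x _; rewrite pointwise.
rewrite (ge0_integral_EFinD (fun x => p x * E x + lambda * pdiv (p x) (p0 x))%R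
  (fun x => lambda * q x)%R)//;
  [|exact: measurable_funD|by move=> x; rewrite addr_ge0].
rewrite (ge0_integral_EFinD (fun x => lambda * pdiv (p x) (q x))%R)//;
  [|exact: measurable_funD|by move=> x; rewrite addr_ge0].
rewrite (ge0_integral_EFinD (fun x => lambda * p0 x)%R)//.
rewrite (ge0_integral_EFinD (fun x => p x * E x)%R)//.
rewrite !ge0_integral_EFinZl//.
rewrite -!KL_pdiv// !density_int1 !mule1.
(* The integrals of [lambda q] and [lambda p0] both equal the finite number [lambda], which cancels
   even if the divergences are infinite. *)
rewrite [lambda%:E + (- _)%:E]addeC addeA.
by move=> /(congr1 (fun y => y - lambda%:E)); rewrite /= !addeK.
Qed.

Lemma measurable_gibbs (p0 : density nu) (E : T -> R) (c lambda : R) :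
    measurable_fun setT E ->
  measurable_fun setT (fun x => c * p0 x * expR (- (1 / lambda * E x)))%R.
Proof.
move=> mE; apply: measurable_funM.
  by apply: measurable_funM => //; exact: measurable_density.
apply: measurableT_comp => //; apply: measurable_funN.
exact: measurable_funM.
Qed.

(** [E >= 0] bounds the integrand by [p0], whence [Z <= 1]. Positivity of [Z] comes from that of the
    integrand, as [nu] is not the zero measure. *)
Lemma partition_functionP (p0 : density nu) (E : T -> R) (lambda : R) :
    measurable_fun setT E -> (forall x, (0 <= E x)%R) ->
    (forall x, (0 < p0 x)%R) -> (0 < lambda)%R ->
  exists2 Z : R, (0 < Z <= 1)%R &
    Z%:E = \int[nu]_x (p0 x * expR (- (1 / lambda * E x)))%:E.
Proof.
move=> mE E0 p00 l0; set f := fun x => (p0 x * expR (- (1 / lambda * E x)))%R.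
have f0 x : (0 < f x)%R by rewrite mulr_gt0// expR_gt0.
have mf : measurable_fun setT (fun x => (f x)%:E).
  apply/measurable_EFinP.
  apply: (eq_measurable_fun _ _ (measurable_gibbs p0 E 1%R lambda mE)).
  by move=> x _; rewrite mul1r.
have mp0 : measurable_fun setT (fun x => (p0 x)%:E).
  by apply/measurable_EFinP; exact: measurable_density.
suff /andP[Z0 Z1] : 0 < \int[nu]_x (f x)%:E <= 1.
  have Zfin : \int[nu]_x (f x)%:E \is a fin_num.
    by rewrite ge0_fin_numE ?(ltW Z0)// (le_lt_trans Z1)// ltry.
  by exists (fine (\int[nu]_x (f x)%:E)); rewrite -?lte_fin -?lee_fin fineK// Z0.
apply/andP; split; last first.
  rewrite -(density_int1 p0); apply: ge0_le_integral => //.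
  - by move=> x _; rewrite lee_fin; exact: ltW (f0 x).
  - move=> x _; rewrite lee_fin ler_piMr ?density_ge0//.
    by rewrite -expR0 ler_expR oppr_le0 mulr_ge0// divr_ge0// ltW.
rewrite lt0e; apply/andP; split; last first.
  by apply: integral_ge0 => x _; rewrite lee_fin; exact: ltW (f0 x).
apply/eqP => intf0.
have /ae_eq_integral_abs -/(_ measurableT mf) aef : \int[nu]_x `|(f x)%:E| = 0.
  rewrite -[RHS]intf0; apply: eq_integral => x _.
  by rewrite gee0_abs// lee_fin; exact: ltW (f0 x).
(* A positive function that is 0 almost everywhere makes every almost-everywhere statement true, in
   particular [p0 = 0], against its integral being 1. *)
have : \int[nu]_x (p0 x)%:E = \int[nu]_x (cst 0 x).
  apply: ae_eq_integral => //; apply: filterS aef => x /(_ I) [fx0].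
  by have := f0 x; rewrite fx0 ltxx.
by rewrite density_int1 integral0 => -[/eqP]; rewrite oner_eq0.
Qed.

End kullback_leibler.

(** * Expectation under a law given by its density *)

Lemma integral_density_prob d (T : measurableType d) (R : realType)
    (nu : {sigma_finite_measure set T -> \bar R}) (p : density nu)
    (f : T -> \bar R) :
  measurable_fun setT f -> (forall x, (0 <= f x)%E) ->
  (\int[density_prob p]_x f x = \int[nu]_x (f x * (p x)%:E))%E.
Proof.
move=> mf f0.
have mp : measurable_fun setT (fun x => (p x)%:E).
  by apply/measurable_EFinP; exact: measurable_density.
have dom : density_prob p `<< nu.
  apply/null_content_dominatesP => A mA A0; rewrite /density_prob.
  by rewrite null_set_integral//; exact: measurable_funTS.
have fge0 := Radon_Nikodym_SigmaFinite.f_ge0 dom.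
have fint := Radon_Nikodym_SigmaFinite.f_integrable dom.
rewrite -(Radon_Nikodym_SigmaFinite.change_of_variables dom)//.
have mRN := measurable_int _ fint.
apply: ae_eq_integral => //; [exact: emeasurable_funM|exact: emeasurable_funM|].
(* Both functions integrate to [density_prob p A] over every measurable [A], so the Radon-Nikodym
   derivative is [p] almost everywhere. *)
have aeRN : ae_eq nu setT (Radon_Nikodym_SigmaFinite.f (density_prob p) nu)
    (fun x => (p x)%:E).
  apply: integral_ae_eq => // A _ mA.
  by rewrite -Radon_Nikodym_SigmaFinite.f_integral.
by apply: filterS aeRN => x /[apply] ->.
Qed.

(** * Optimality and uniqueness of the Gibbs density *)

Theorem theorem1 (R : realType) (n m d T : nat)
    (f : 'R[R]_n -> 'R[R]_m -> 'R[R]_n)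
    (ell : 'I_T -> 'R[R]_n -> 'R[R]_m -> R) (ellT : 'R[R]_n -> R)
    (pi : 'R[R]_d -> 'R[R]_n -> 'R[R]_m) (mu : probability 'R[R]_n R)
    (p0 : density (lebesgueRn R d)) (lambda : R) (E : 'R[R]_d -> R)
    (cost_meas : measurable_fun setT
      (fun z : 'R[R]_n * 'R[R]_d => rollout_cost f ell ellT pi z.1 z.2))
    (p0_gt0 : forall theta, 0 < p0 theta)
    (lambda_gt0 : 0 < lambda)
    (ell_ge0 : forall t x u, 0 <= ell t x u)
    (ellT_ge0 : forall x, 0 <= ellT x)
    (E_def : forall theta, energy f ell ellT pi mu theta = (E theta)%:E)
    (E_meas : measurable_fun setT E) :
  exists (Z : R) (pstar : density (lebesgueRn R d)),
    [/\ 0 < Z,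
        Z%:E = (\int[lebesgueRn R d]_theta
                  (p0 theta * expR (- (1 / lambda * E theta)))%:E)%E,
        forall theta,
          pstar theta = 1 / Z * p0 theta * expR (- (1 / lambda * E theta)) &
        forall p : density (lebesgueRn R d),
          is_minimizer (objective f ell ellT pi mu p0 lambda) p <->
          {ae lebesgueRn R d, forall theta, p theta = pstar theta}].
Proof.
have cost_ge0 x theta : 0 <= rollout_cost f ell ellT pi x theta.
  by rewrite addr_ge0// sumr_ge0.
have E_ge0 theta : 0 <= E theta.
  by rewrite -lee_fin -E_def /energy expectation_ge0.
have [Z Z01 ZE] :=
  partition_functionP p0 E lambda E_meas E_ge0 p0_gt0 lambda_gt0.
have /andP[Z_gt0 _] := Z01.
pose q theta := 1 / Z * p0 theta * expR (- (1 / lambda * E theta)).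
have q_gt0 theta : 0 < q theta by rewrite !mulr_gt0 ?expR_gt0// invr_gt0.
have q_meas : measurable_fun setT q by exact: measurable_gibbs.
have q_int1 : (\int[lebesgueRn R d]_theta (q theta)%:E = 1)%E.
  under eq_integral do rewrite /q -mulrA.
  rewrite ge0_integral_EFinZl//.
  - by rewrite -ZE -EFinM div1r mulVf// gt_eqF.
  - apply: (eq_measurable_fun _ _ (measurable_gibbs p0 E 1 lambda E_meas)).
    by move=> theta _; rewrite mul1r.
  - by move=> theta; rewrite mulr_ge0 ?expR_ge0// ltW.
  - by rewrite divr_ge0// ltW.
pose pstar := Density (fun theta => ltW (q_gt0 theta)) q_meas q_int1.
exists Z, pstar; split => // p.
have objE r : objective f ell ellT pi mu p0 lambda r =
    (lambda%:E * KL r pstar + (- (lambda * ln Z))%:E)%E.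
  rewrite -(free_energy_KL r p0 pstar E)//.
  (* Tonelli applies to the nonnegative cost; integrating over [x0] first turns the inner integral
     into [E theta]. *)
  congr (_ + _)%E; rewrite unlock fubini_tonelli2/=.
  - rewrite (eq_integral (EFin \o E)); last first.
      by move=> theta _; rewrite /= -E_def /energy unlock.
    rewrite integral_density_prob//.
    + by apply: eq_integral => theta _; rewrite /= -EFinM mulrC.
    + exact/measurable_EFinP.
  - exact/measurable_EFinP.
  - by move=> [x theta]/=; rewrite lee_fin.
have pstar_gt0 : forall theta, 0 < pstar theta by [].
have KL_pstar : KL pstar pstar = 0%E.
  by apply/KL_eq0 => //; exact: aeW.
(* The objective at [pstar] is the finite constant [- lambda ln Z]. Comparing a minimizer with
   [pstar] forces [lambda * KL p pstar <= 0]; conversely, zero divergence attains this lower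
   bound. *)
rewrite -KL_eq0//; split=> [pmin|KLp0 r].
  have := pmin pstar; rewrite !objE KL_pstar mule0 add0e => h.
  apply/eqP; rewrite eq_le KL_ge0// andbT.
  rewrite -(@pmule_rle0 _ lambda%:E) ?lte_fin//.
  by move: h; rewrite -leeBrDr// -EFinB subrr.
rewrite !objE KLp0 mule0 add0e leeDr// mule_ge0 ?KL_ge0// lee_fin.
exact: ltW.
Qed.
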